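(* Let $\mathbf{Subdiv}$ and $\mathbf{JoinAdm}^\circ$ be the categories defined in the context. Define functors $\mathbf{CYL}:\mathbf{Subdiv}\to\mathbf{JoinAdm}^\circ$ and $\mathbf{MAP}:\mathbf{JoinAdm}^\circ\to\mathbf{Subdiv}$ as follows. On objects, $\mathbf{CYL}(\sigma:X\to Y)=(\operatorname{Cyl}(\sigma),\rho_{\operatorname{Cyl}(\sigma)},\hat 0_Y)$, where $\rho_{\operatorname{Cyl}(\sigma)}$ equals $\rho_X$ on $X$ and $\rho_Y+1$ on $Y$; and $\mathbf{MAP}(\Gamma,\rho_\Gamma,q)$ is the function $\Gamma\smallsetminus\Gamma_{\ge q}\to\Gamma_{\ge q}$, $x\mapsto x\vee q$, where $\Gamma\smallsetminus\Gamma_{\ge q}$ has rank function the restriction of $\rho_\Gamma$ and $\Gamma_{\ge q}$ has rank function the restriction of $\rho_\Gamma-1$. On morphisms, $\mathbf{CYL}$ sends a commutative square with horizontal maps $\sigma:X\to Y$, $\sigma':X'\to Y'$ and vertical maps $\phi_1:X\to X'$, $\phi_2:Y\to Y'$ (so $\phi_2\circ\sigma=\sigma'\circ\phi_1$) to the function $\phi:\operatorname{Cyl}(\sigma)\to\operatorname{Cyl}(\sigma')$ given by $\phi(z)=\phi_1(z)$ for $z\in X$ and $\phi(z)=\phi_2(z)$ for $z\in Y$; and $\mathbf{MAP}$ sends a morphism $(\Gamma,\rho_\Gamma,q)\to(\Gamma',\rho_{\Gamma'},q')$ given by $\phi:\Gamma\to\Gamma'$ to the commutative square whose horizontal maps are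 $\mathbf{MAP}(\Gamma,\rho_\Gamma,q):X\to Y$ and $\mathbf{MAP}(\Gamma',\rho_{\Gamma'},q'):X'\to Y'$ and whose vertical maps are the restrictions $\phi_1:X\to X'$ and $\phi_2:Y\to Y'$ of $\phi$. Then $\mathbf{CYL}$ and $\mathbf{MAP}$ are well-defined functors, and they are mutually inverse isomorphisms of categories.
   Context: All posets are finite. In a poset $B$, $z'$ covers $z$ if $z<z'$ and no element lies strictly between them. A rank function for a nonempty poset $B$ is a function $\rho_B:B\to\mathbb{Z}$ with $\rho_B(z')=\rho_B(z)+1$ whenever $z'$ covers $z$; $B$ is ranked if one exists. A ranked poset $B$ is locally Eulerian if $\sum_{z\le z''\le z'}(-1)^{\rho_B(z'')}=0$ for all $z<z'$ in $B$. It is lower Eulerian if in addition it has a unique minimal element, denoted $\hat 0_B$. Let $X,Y$ be lower Eulerian posets with rank functions $\rho_X,\rho_Y$. A function $\sigma:X\to Y$ is order-preserving if $x\le x'$ implies $\sigma(x)\le\sigma(x')$; rank-increasing if $\rho_X(x)\le\rho_Y(\sigma(x))$ for all $x\in X$. An order-preserving, rank-increasing $\sigma$ is strongly surjective if it is surjective and for all $x\in X$, $y\in Y$ with $\sigma(x)\le y$ there is $x'\in X$ with $x\le x'$, $\rho_X(x')=\rho_Y(y)$ and $\sigma(x')=y$. A strong formal subdivision is an order-preserving, rank-increasing, strongly surjective $\sigma:X\to Y$ such that for all $x\in X$, $y\in Y$ with $\sigma(x)\le y$, $$\sum_{x\le x'\in X,\ \sigma(x')=y}(-1)^{\rho_Y(y)-\rho_X(x')}=1.$$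 For $z\in B$, $B_{\ge z}=\{z'\in B: z\le z'\}$. The join $z\vee z'$ is the unique minimal element of $B_{\ge z}\cap B_{\ge z'}$, when this set is nonempty and has a unique minimal element (then the join exists). An element $q\in B$ is join-admissible if $z\vee q$ exists for all $z\in B$. For an order-preserving $\sigma:X\to Y$, the non-Hausdorff mapping cylinder $\operatorname{Cyl}(\sigma)$ is the poset on the disjoint union of $X$ and $Y$ with $z\le z'$ iff (1) $z,z'\in X$ and $z\le z'$ in $X$, or (2) $z,z'\in Y$ and $z\le z'$ in $Y$, or (3) $z\in X$, $z'\in Y$ and $\sigma(z)\le z'$ in $Y$. $X$ and $Y$ are identified with their images in the disjoint union. Categories. $\mathbf{EulPos}$ is the category with objects pairs $(B,\rho_B)$, $B$ a lower Eulerian poset with rank function $\rho_B$, and morphisms the strong formal subdivisions. $\mathbf{Subdiv}$ is its arrow category: objects are strong formal subdivisions $\sigma:X\to Y$ between lower Eulerian posets with rank functions, and a morphism from $\sigma:X\to Y$ to $\sigma':X'\to Y'$ is a commutative square $\phi_2\circ\sigma=\sigma'\circ\phi_1$ with $\phi_1:X\to X'$, $\phi_2:Y\to Y'$ strong formal subdivisions; composition is by stacking squares. $\mathbf{JoinAdm}^\circ$ is the category with objects triples $(\Gamma,\rho_\Gamma,q)$, where $\Gamma$ is a lower Eulerian poset with rank function $\rho_\Gamma$ and $q\neq\hat 0_\Gamma$ is a join-admissible element; a morphism $(\Gamma,\rho_\Gamma,q)\to(\Gamma',\rho_{\Gamma'},q')$ is a strong formal subdivision $\phi:\Gamma\to\Gamma'$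 such that $\phi(q)=q'$ and $\phi(z\vee q)=\phi(z)\vee q'$ for all $z\in\Gamma\smallsetminus\Gamma_{\ge q}$. *)

(* Defs.v *)
From HB Require Import structures.
From mathcomp Require Import all_boot all_order all_algebra.
From mathcomp Require Import boolp.

Set Implicit Arguments.
Unset Strict Implicit.
Unset Printing Implicit Defensive.

Import Order.TTheory GRing.Theory Num.Theory.
Local Open Scope order_scope.

Section Posets.
Context {d : Order.disp_t} {B : finPOrderType d}.
Implicit Types (z q m : B) (A : {set B}).

Definition covers z' z := (z < z') && [forall w, ~~ (z < w < z')].

Definition minimal_in A m := (m \in A) && [forall z in A, ~~ (z < m)].

Definition unique_minimal A m := [forall z, minimal_in A z == (z == m)].

Definition upset z : {set B} := [set z' | z <= z'].

Definition is_join z z' m := unique_minimal (upset z :&: upset z') m.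

Definition join_admissible q : Prop := forall z, exists m, is_join z q m.

Lemma unique_minimal_in A m : unique_minimal A m -> m \in A.
Proof. by move=> /forallP /(_ m); rewrite eqxx => /eqP /andP[]. Qed.

Lemma is_join_le z q m : is_join z q m -> (z <= m) && (q <= m).
Proof. by move=> /unique_minimal_in; rewrite !inE. Qed.

End Posets.

Definition sub_poset {d} {B : finPOrderType d} (P : pred B) := {z : B | P z}.

HB.instance Definition _ d (B : finPOrderType d) (P : pred B) :=
  SubFinite.on (sub_poset P).
HB.instance Definition _ d (B : finPOrderType d) (P : pred B) :=
  [SubChoice_isSubPOrder of sub_poset P by <: with d].

(* The non-Hausdorff mapping cylinder; [inl] and [inr] are the inclusions of
   [X] and [Y]. *)
Section Cylinder.
Context {dX dY : Order.disp_t} {X : finPOrderType dX} {Y : finPOrderType dY}.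
Variable s : X -> Y.

Definition cyl of {homo s : x x' / x <= x'} := (X + Y)%type.

Variable s_homo : {homo s : x x' / x <= x'}.

HB.instance Definition _ := Finite.on (cyl s_homo).

Definition cyl_le (z z' : cyl s_homo) : bool :=
  match z, z' with
  | inl x, inl x' => x <= x'
  | inr y, inr y' => y <= y'
  | inl x, inr y => s x <= y
  | inr _, inl _ => false
  end.

Lemma cyl_le_refl : reflexive cyl_le.
Proof. by case=> z /=; exact: lexx. Qed.

Lemma cyl_le_anti : antisymmetric cyl_le.
Proof. by case=> z [] z' //=; rewrite ?andbF // => /le_anti ->. Qed.

Lemma cyl_le_trans : transitive cyl_le.
Proof.
case=> z2 [] z1 [] z3 //=; try exact: le_trans.
by move=> /s_homo; exact: le_trans.
Qed.

HB.instance Definition _ :=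
  Order.Le_isPOrder.Build dX (cyl s_homo) cyl_le_refl cyl_le_anti cyl_le_trans.

End Cylinder.

Record rposet := RPoset {
  disp : Order.disp_t;
  carrier :> finPOrderType disp;
  rk : carrier -> int
}.

Definition is_rank_function {d} (B : finPOrderType d) (r : B -> int) : Prop :=
  forall z z' : B, covers z' z -> r z' = (r z + 1)%R.

(* The exponents are integers, possibly negative: [(-1) ^ k] is the integer
   power of the unit [-1] of [int]. *)
Definition locally_eulerian (B : rposet) : Prop :=
  is_rank_function (@rk B) /\
  forall z z' : B, z < z' ->
    (\sum_(w : B | (z <= w)%O && (w <= z')%O) (-1 : int) ^ rk w)%R = 0%R.

Definition lower_eulerian (B : rposet) : Prop :=
  locally_eulerian B /\ exists m : B, unique_minimal [set: B] m.

Definition order_preserving (X Y : rposet) (s : X -> Y) : Prop :=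
  {homo s : x x' / x <= x'}.

Definition rank_increasing (X Y : rposet) (s : X -> Y) : Prop :=
  forall x, (rk x <= rk (s x))%R.

Definition strongly_surjective (X Y : rposet) (s : X -> Y) : Prop :=
  (forall y, exists x, s x = y) /\
  forall (x : X) (y : Y), s x <= y ->
    exists x' : X, [/\ x <= x', rk x' = rk y & s x' = y].

Definition strong_formal_subdivision (X Y : rposet) (s : X -> Y) : Prop :=
  [/\ order_preserving s, rank_increasing s, strongly_surjective s &
      forall (x : X) (y : Y), s x <= y ->
        (\sum_(x' : X | (x <= x')%O && (s x' == y)) (-1 : int) ^ (rk y - rk x'))%R
        = 1%R].

Lemma sfs_id (X : rposet) : strong_formal_subdivision (@id X).
Proof.
split=> //; first by split=> [y|x y xy]; [exists y | exists y].
move=> x y /= xy; rewrite (big_pred1 y) ?subrr ?expr0z // => x' /=.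
by rewrite /= -[RHS]andTb; case: eqP => [->|]; rewrite ?xy ?andbF.
Qed.

Lemma sfs_comp (X Y Z : rposet) (s : X -> Y) (t : Y -> Z) :
  strong_formal_subdivision s -> strong_formal_subdivision t ->
  strong_formal_subdivision (t \o s).
Proof.
move=> [sO sR [sS sL] sE] [tO tR [tS tL] tE]; split.
- by move=> x x' /sO /tO.
- by move=> x; exact: le_trans (sR x) (tR _).
- split=> [z|x z /= tsx].
    by have [y <-] := tS z; have [x <-] := sS y; exists x.
  have [y [sxy ry ty]] := tL _ _ tsx.
  have [x' [xx' rx' sx']] := sL _ _ sxy.
  by exists x'; split; rewrite //= ?sx' // rx'.
move=> x z /= tsx; rewrite -[RHS](tE _ _ tsx).
rewrite (partition_big s (fun y => (s x <= y) && (t y == z))) /=; last first.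
  by move=> x' /andP[xx' ->]; rewrite (sO _ _ xx').
apply: eq_bigr => y /andP[sxy /eqP ty].
rewrite -[RHS]mulr1 -[X in (_ * X)%R](sE _ _ sxy) mulr_sumr; apply: eq_big => [x'|x'].
  by case: (s x' =P y) => [->|]; rewrite ?ty ?eqxx ?andbT ?andbF.
move=> _; rewrite -exprzDr //; congr (_ ^ _)%R.
by rewrite addrA subrK.
Qed.

Record category := Category {
  obj :> Type;
  Mor : obj -> obj -> Type;
  idmor : forall x, Mor x x;
  compm : forall x y z, Mor y z -> Mor x y -> Mor x z;
  comp1m : forall x y (f : Mor x y), compm (idmor y) f = f;
  compm1 : forall x y (f : Mor x y), compm f (idmor x) = f;
  compA : forall x y z w (h : Mor z w) (g : Mor y z) (f : Mor x y),
    compm h (compm g f) = compm (compm h g) f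
}.
Arguments Mor {_} _ _.
Arguments idmor {_} _.
Arguments compm {_ _ _ _} _ _.

(* Functors with a prescribed action [F] on objects. *)
Record functor_on (C D : category) (F : C -> D) := Functor {
  fmap :> forall x y : C, Mor x y -> Mor (F x) (F y);
  fmap1 : forall x, fmap (idmor x) = idmor (F x);
  fmapM : forall x y z (g : Mor y z) (f : Mor x y),
    fmap (compm g f) = compm (fmap g) (fmap f)
}.
Arguments fmap {C D F} _ {x y} _.

Program Definition functor_id (C : category) : functor_on (fun x : C => x) :=
  @Functor C C _ (fun _ _ f => f) _ _.

Program Definition functor_comp (C D E : category) (G : D -> E) (F : C -> D)
    (Gm : functor_on G) (Fm : functor_on F) : functor_on (fun x => G (F x)) :=
  @Functor C E _ (fun _ _ f => fmap Gm (fmap Fm f)) _ _.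
Next Obligation. by move=> *; rewrite !fmap1. Qed.
Next Obligation. by move=> *; rewrite !fmapM. Qed.

Definition isomorphism (C : category) (x y : C) (f : Mor x y) : Prop :=
  exists g : Mor y x, compm g f = idmor x /\ compm f g = idmor y.

Definition natural_isomorphism (C D : category) (F G : C -> D)
    (Fm : functor_on F) (Gm : functor_on G)
    (eta : forall x, Mor (F x) (G x)) : Prop :=
  (forall x, isomorphism (eta x)) /\
  (forall x y (f : Mor x y),
     compm (eta y) (fmap Fm f) = compm (fmap Gm f) (eta x)).

Section ArrowCategory.
Variable C : category.

Record arrow := Arrow { dom : C; cod : C; arr : Mor dom cod }.

Record square (s t : arrow) := Square {
  sq_dom : Mor (dom s) (dom t);
  sq_cod : Mor (cod s) (cod t);
  sq_comm : compm sq_cod (arr s) = compm (arr t) sq_dom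
}.

Lemma square_eq s t (f g : square s t) :
  sq_dom f = sq_dom g -> sq_cod f = sq_cod g -> f = g.
Proof.
case: f g => [f1 f2 fE] [g1 g2 gE] /= e1 e2; subst.
by rewrite (Prop_irrelevance fE gE).
Qed.

Program Definition square_id s : square s s :=
  @Square s s (idmor _) (idmor _) _.
Next Obligation. by rewrite comp1m compm1. Qed.

Program Definition square_comp s t u (g : square t u) (f : square s t) :
    square s u :=
  @Square s u (compm (sq_dom g) (sq_dom f)) (compm (sq_cod g) (sq_cod f)) _.
Next Obligation.
by rewrite -compA sq_comm compA sq_comm compA.
Qed.

Program Definition arrow_category : category :=
  @Category arrow square square_id square_comp _ _ _.
Next Obligation. by move=> *; apply: square_eq; rewrite /= comp1m. Qed.
Next Obligation. by move=> *; apply: square_eq; rewrite /= compm1. Qed.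
Next Obligation. by move=> *; apply: square_eq; rewrite /= compA. Qed.

End ArrowCategory.

Record eulpos := EulPosObj {
  eul_rposet :> rposet;
  eulP : lower_eulerian eul_rposet
}.

Definition zero (B : eulpos) : B := xchoose (proj2 (eulP B)).

Record sfs_map (X Y : rposet) := SfsMap {
  sfs_fun :> X -> Y;
  sfsP : strong_formal_subdivision sfs_fun
}.

Lemma sfs_map_eq X Y (f g : sfs_map X Y) : f =1 g -> f = g.
Proof.
case: f g => [f fP] [g gP] /= /funext e; subst.
by rewrite (Prop_irrelevance fP gP).
Qed.

Program Definition EulPos : category :=
  @Category eulpos (fun X Y => sfs_map X Y)
    (fun X => SfsMap (@sfs_id X))
    (fun X Y Z g f => SfsMap (sfs_comp (sfsP f) (sfsP g))) _ _ _.
Next Obligation. by move=> *; exact: sfs_map_eq. Qed.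
Next Obligation. by move=> *; exact: sfs_map_eq. Qed.
Next Obligation. by move=> *; exact: sfs_map_eq. Qed.

(* Isomorphic objects of [EulPos] are equal up to renaming of elements. *)
Lemma EulPos_isoP (X Y : EulPos) (f : Mor X Y) :
  isomorphism f <->
  [/\ bijective (sfs_fun f),
      {mono sfs_fun f : x x' / x <= x'} &
      forall x, rk (sfs_fun f x) = rk x].
Proof.
split=> [[g [gf fg]]|[[g gK fK] fm fr]].
  have gK x : sfs_fun g (sfs_fun f x) = x by rewrite -[RHS]/(sfs_fun (idmor X) x) -gf.
  have fK y : sfs_fun f (sfs_fun g y) = y by rewrite -[RHS]/(sfs_fun (idmor Y) y) -fg.
  have [fO fR _ _] := sfsP f; have [gO gR _ _] := sfsP g.
  split=> [|x x'|x]; first by exists (sfs_fun g).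
    by apply/idP/idP => [/gO|/fO //]; rewrite !gK.
  by apply: le_anti; rewrite fR -{2}(gK x) gR.
have gm : {mono g : y y' / y <= y'} by move=> y y'; rewrite -fm !fK.
have gr y : rk (g y) = rk y by rewrite -fr fK.
have gS : strong_formal_subdivision g.
  split=> [y y'|y||y x gyx]; first by rewrite gm.
  - by rewrite gr.
  - split=> [x|y x gyx]; first by exists (sfs_fun f x).
    by exists (sfs_fun f x); split; rewrite ?gK ?fr // -gm gK.
  rewrite (big_pred1 (sfs_fun f x)) ?fr ?subrr ?expr0z // => y' /=.
  apply/andP/eqP => [[_ /eqP <-]|->]; first by rewrite fK.
  by rewrite gK -gm gK.
exists (SfsMap gS); split; exact: sfs_map_eq.
Qed.

Definition Subdiv : category := arrow_category EulPos.

Definition join_adm_point (B : rposet) (q : B) : Prop :=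
  ~~ unique_minimal [set: B] q /\ join_admissible q.

Record join_adm := JoinAdmObj {
  ja_pos :> eulpos;
  ja_pt : ja_pos;
  ja_ptP : join_adm_point ja_pt
}.

Definition joinq (G : join_adm) (z : G) : G := xchoose (proj2 (ja_ptP G) z).

Lemma joinqP (G : join_adm) (z : G) : is_join z (ja_pt G) (joinq z).
Proof. exact: xchooseP. Qed.

Definition join_adm_morphism (G G' : join_adm) (phi : G -> G') : Prop :=
  [/\ strong_formal_subdivision phi,
      phi (ja_pt G) = ja_pt G' &
      forall z : G, ~~ (ja_pt G <= z) -> phi (joinq z) = joinq (phi z)].

Record ja_map (G G' : join_adm) := JaMap {
  ja_fun :> G -> G';
  ja_mapP : join_adm_morphism ja_fun
}.

Lemma ja_map_eq G G' (f g : ja_map G G') : f =1 g -> f = g.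
Proof.
case: f g => [f fP] [g gP] /= /funext e; subst.
by rewrite (Prop_irrelevance fP gP).
Qed.

Lemma joinq_ge (G : join_adm) (z : G) : ja_pt G <= z -> joinq z = z.
Proof.
move=> qz; have [/andP[zj _] /forallP/(_ z)/eqP] := (is_join_le (joinqP z), joinqP z).
rewrite /minimal_in !inE lexx qz /= => zE; apply/esym/eqP; rewrite -zE.
by apply/forall_inP => w; rewrite !inE => /andP[/le_gtF ->].
Qed.

Lemma join_adm_id (G : join_adm) : join_adm_morphism (@id G).
Proof. by split=> //; exact: sfs_id. Qed.

Lemma join_adm_comp (G1 G2 G3 : join_adm) (f : G1 -> G2) (g : G2 -> G3) :
  join_adm_morphism f -> join_adm_morphism g -> join_adm_morphism (g \o f).
Proof.
move=> [fS fq fj] [gS gq gj]; split=> [||z qz /=].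
- exact: sfs_comp.
- by rewrite /= fq.
rewrite fj //; have [qfz|] := boolP (ja_pt G2 <= f z); last exact: gj.
by rewrite !joinq_ge // -gq; case: gS => gO _ _ _; exact: gO.
Qed.

Program Definition JoinAdm : category :=
  @Category join_adm ja_map
    (fun G => JaMap (@join_adm_id G))
    (fun G1 G2 G3 g f => JaMap (join_adm_comp (ja_mapP f) (ja_mapP g))) _ _ _.
Next Obligation. by move=> *; exact: ja_map_eq. Qed.
Next Obligation. by move=> *; exact: ja_map_eq. Qed.
Next Obligation. by move=> *; exact: ja_map_eq. Qed.

Definition sdom (s : Subdiv) : eulpos := dom s.
Definition scod (s : Subdiv) : eulpos := cod s.
Definition sfun (s : Subdiv) : sdom s -> scod s := sfs_fun (arr s).

Lemma sfun_homo (s : Subdiv) : {homo @sfun s : x x' / x <= x'}.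
Proof. by have [] := sfsP (arr s). Qed.

Definition Cyl (s : Subdiv) : rposet :=
  @RPoset _ (cyl (@sfun_homo s))
    (fun z => match z with inl x => rk x | inr y => (rk y + 1)%R end).

Definition cyl_inl (s : Subdiv) (x : sdom s) : Cyl s := inl x.
Definition cyl_inr (s : Subdiv) (y : scod s) : Cyl s := inr y.

Definition CYL_object_wd (s : Subdiv) : Prop :=
  lower_eulerian (Cyl s) /\ join_adm_point (cyl_inr (zero (scod s))).

Definition CYL_object (wd : forall s, CYL_object_wd s) (s : Subdiv) : JoinAdm :=
  @JoinAdmObj (EulPosObj (proj1 (wd s))) _ (proj2 (wd s)).

Definition lower_part (G : JoinAdm) : rposet :=
  @RPoset _ (sub_poset (fun z : (G : join_adm) => ~~ (ja_pt G <= z)))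
    (fun z => rk (val z)).

Definition upper_part (G : JoinAdm) : rposet :=
  @RPoset _ (sub_poset (fun z : (G : join_adm) => ja_pt G <= z))
    (fun z => (rk (val z) - 1)%R).

Lemma joinq_upper (G : join_adm) (z : G) : ja_pt G <= joinq z.
Proof. by have /is_join_le/andP[] := joinqP z. Qed.

Definition join_map (G : JoinAdm) (x : lower_part G) : upper_part G :=
  exist _ (joinq (val x)) (joinq_upper (val x)).

Definition MAP_object_wd (G : JoinAdm) : Prop :=
  lower_eulerian (lower_part G) /\ lower_eulerian (upper_part G) /\
  strong_formal_subdivision (@join_map G).

Definition MAP_object (wd : forall G, MAP_object_wd G) (G : JoinAdm) : Subdiv :=
  @Arrow EulPos (EulPosObj (proj1 (wd G))) (EulPosObj (proj1 (proj2 (wd G))))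
    (SfsMap (proj2 (proj2 (wd G)))).

(* Main.v *)
Require Import Defs.
From mathcomp Require Import all_boot all_order all_algebra.

(** The two constructions undo each other on elements: a cylinder is a disjoint
    union of a down-set [X] and an up-set [Y], and a join-admissible [q] splits
    [Gamma] into the down-set of the [z] with [~~ (q <= z)] and the up-set of
    the [z >= q].  For [x] in the first and [y] in the second, [x <= y] holds iff
    [joinq x <= y], which is the order relation of the cylinder of [joinq].
    So both composites are renamings of elements that respect order and rank
    ([unit_iso], [counit_iso]), and the content is that both functors are well
    defined.

    All signed sums below use that the sign condition of a strong formal
    subdivision says that the fibre of [y] above [x] has the same signed sum as
    the single element [y] ([sum_sign_fibre]).

    - The cylinder is locally Eulerian because an interval from [x] in [X] to
      [y] in [Y] is the union of a part in [X], whose sum is that of the interval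
      [[sfun x, y]] of [Y] by grouping along fibres ([cyl_mixed_sum]), and of
      that interval itself with ranks shifted by one: the two sums cancel.

    - Conversely, for [x] not above [q], the sum over the interval [[x, y]] of
      [Gamma] groups along the fibres of [joinq].  As it vanishes for every
      [y >= joinq x], induction on [y] determines the sum over each fibre
      ([joinq_fibre_sum]).  This is the sign condition for [joinq].  Since the
      sum is nonzero the fibre is nonempty, and its maximal elements are covered
      by [y]; this is strong surjectivity ([joinq_strongly_surjective]).

    - A morphism of join-admissible triples restricts to the two parts because
      it reflects the relation of being above [q] ([ja_map_pt_le]).  This is
      again a sign argument: a maximal [m] violating it would contribute a
      single uncancelled term to the difference of two equal fibre sums, the
      one above [m] and the one above [joinq m]. *)

Set Implicit Arguments.
Unset Strict Implicit.
Unset Printing Implicit Defensive.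

Import Order.TTheory GRing.Theory Num.Theory.
Local Open Scope order_scope.

Local Notation sign k := ((-1 : int) ^ k)%R.

(** * Finite posets, least elements and joins *)

(** Also used on the dual order, to descend from the top. *)
Lemma lt_fin_ind d (B : finPOrderType d) (P : B -> Prop) :
  (forall z, (forall w, w < z -> P w) -> P z) -> forall z, P z.
Proof.
move=> step z; have [n] := ubnP #|[pred w | w < z]|.
elim: n z => // n IH z; rewrite ltnS => le_n; apply: step => w wz.
apply: IH; apply: leq_trans le_n; apply: proper_card; apply/properP; split.
  by apply/subsetP => u; rewrite !inE => /lt_trans; apply.
by exists w; rewrite !inE ?ltxx.
Qed.

Lemma exists_maximal d (B : finPOrderType d) (A : pred B) (z : B) : A z ->
  exists m, [/\ A m, z <= m & forall w, m < w -> ~~ A w].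
Proof.
elim/(@lt_fin_ind _ (B^d)): z => z IH Az.
have [/existsP[w /andP[zw Aw]]|/existsPn none] :=
  boolP [exists w : B, @Order.lt _ B z w && A w].
  have [m [Am wm mm]] := IH w zw Aw.
  by exists m; split=> //; exact: le_trans (ltW zw) wm.
by exists z; split=> // w zw; move: (none w); rewrite zw.
Qed.

(** In a finite poset every element of [A] lies above a minimal one, so a
    unique minimal element is a least element. *)
Lemma unique_minimalP d (B : finPOrderType d) (A : {set B}) (m : B) :
  reflect (m \in A /\ forall z, z \in A -> m <= z) (unique_minimal A m).
Proof.
apply: (iffP idP) => [um|[mA least]].
  split=> [|z zA]; first exact: unique_minimal_in um.
  have [w [wA wz min_w]] := @exists_maximal _ (B^d) (mem A) z zA.
  suff /eqP <- : w == m by [].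
  move/forallP/(_ w)/eqP: um => <-; apply/andP; split=> //.
  by apply/forall_inP => u uA; apply: contraL uA => /min_w.
apply/forallP => z; apply/eqP; apply/idP/eqP => [/andP[zA /forall_inP min_z]|->].
  by move: (least z zA) (min_z m mA); rewrite le_eqVlt => /orP[/eqP ->|->].
by apply/andP; split=> //; apply/forall_inP => z' /least /le_gtF ->.
Qed.

Lemma joinq_le (G : join_adm) (z w : G) :
  (joinq z <= w) = (z <= w) && (ja_pt G <= w).
Proof.
have /unique_minimalP[] := joinqP z; rewrite !inE => /andP[zj qj] least.
apply/idP/idP => [jw|zqw]; first by rewrite !(le_trans _ jw).
by apply: least; rewrite !inE.
Qed.

Lemma joinqE (G : join_adm) (z m : G) :
  (forall w, (m <= w) = (z <= w) && (ja_pt G <= w)) -> joinq z = m.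
Proof. by move=> mE; apply: le_anti; rewrite joinq_le -!mE lexx mE -joinq_le lexx. Qed.

Lemma le_joinq (G : join_adm) (z : G) : z <= joinq z.
Proof. by have /andP[] := is_join_le (joinqP z). Qed.

Lemma lt_joinq (G : join_adm) (z : G) : ~~ (ja_pt G <= z) -> z < joinq z.
Proof.
move=> qz; rewrite lt_neqAle le_joinq andbT.
by apply: contraNneq qz => ->; exact: joinq_upper.
Qed.

Lemma zero_le (B : eulpos) (z : B) : zero B <= z.
Proof.
have /unique_minimalP[_] := xchooseP (proj2 (eulP B)).
by apply; rewrite inE.
Qed.

Lemma zeroE (B : eulpos) (z : B) : (forall w, z <= w) -> zero B = z.
Proof. by move=> z0; apply: le_anti; rewrite zero_le z0. Qed.

(** * Ranks and signs *)

(** A maximal element of the half-open interval from [z] to [z'] is covered by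
    [z'], so the claim follows by induction on [z']. *)
Lemma rank_lt d (B : finPOrderType d) (r : B -> int) (z z' : B) :
  is_rank_function r -> z < z' -> (r z < r z')%R.
Proof.
move=> rP; elim/(@lt_fin_ind _ B): z' => z' IH zz'.
have [|w [/andP[zw wz'] _ max_w]] :=
  @exists_maximal _ _ [pred w | (z <= w) && (w < z')] z.
  by rewrite /= lexx zz'.
have cov : covers z' w.
  rewrite /covers wz'; apply/forallP => u; apply/negP => /andP[wu uz'].
  by move: (max_w u wu); rewrite /= uz' (le_trans zw (ltW wu)).
rewrite (rP _ _ cov) ltzD1; move: zw; rewrite le_eqVlt => /orP[/eqP -> //|zw].
exact/ltW/IH.
Qed.

Lemma signN (k : int) : sign (- k) = sign k.
Proof. by rewrite -exprz_inv invrN1. Qed.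

Lemma signD (k l : int) : sign (k + l) = (sign k * sign l)%R.
Proof. by rewrite exprzDr ?unitrN1. Qed.

Lemma sign_sqr (k : int) : (sign k * sign k = 1)%R.
Proof. by rewrite -{2}signN -signD subrr expr0z. Qed.

(** Signs are their own inverses, so the factor [sign c] can change sides. *)
Lemma sum_sign_fibre (I : finType) (P : pred I) (r : I -> int) (c : int) :
  (\sum_(i | P i) sign (c - r i) = 1)%R <-> (\sum_(i | P i) sign (r i) = sign c)%R.
Proof.
have -> : (\sum_(i | P i) sign (c - r i) = sign c * \sum_(i | P i) sign (r i))%R.
  by rewrite mulr_sumr; apply: eq_bigr => i _; rewrite signD signN.
split=> [e|->]; last exact: sign_sqr.
by rewrite -[LHS]mul1r -{1}(sign_sqr c) -mulrA e mulr1.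
Qed.

Lemma big_sub_poset d (B : finPOrderType d) (P Q : pred B) (F : B -> int) :
  (\sum_(w : sub_poset P | Q (val w)) F (val w) = \sum_(w | P w && Q w) F w)%R.
Proof.
rewrite [RHS](reindex_omap (val : sub_poset P -> B) insub); last first.
  by move=> w /andP[Pw _]; rewrite insubT.
by apply: eq_bigl => w; rewrite valK eqxx andbT (valP w).
Qed.

(** Covers and intervals in a convex subset are those of the ambient poset, and
    the shift [c] multiplies all signs by the same factor. *)
Lemma locally_eulerian_convex (B : rposet) (P : pred B)
    (r : sub_poset P -> int) (c : int) :
  (forall z w z' : B, P z -> P z' -> z <= w -> w <= z' -> P w) ->
  (forall z, r z = (rk (val z) + c)%R) ->
  locally_eulerian B -> locally_eulerian (@RPoset _ (sub_poset P) r).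
Proof.
move=> convex rE [rkB eulB]; split=> [z z' /andP[zz' /forallP cov]|z z' zz'].
  rewrite /= !rE (rkB (val z) (val z')) ?(addrAC _ c) //.
  rewrite /covers; apply/andP; split=> //; apply/forallP => w; apply/negP.
  move=> /andP[zw wz'].
  have Pw := convex _ _ _ (valP z) (valP z') (ltW zw) (ltW wz').
  by move/negP: (cov (Sub w Pw)); apply; apply/andP; split.
pose a : B := val z; pose b : B := val z'.
have -> : (\sum_(w : sub_poset P | (z <= w)%O && (w <= z')%O) sign (r w) =
    (\sum_(w : B | (a <= w)%O && (w <= b)%O) sign (rk w)) * sign c)%R.
  rewrite mulr_suml; transitivity (\sum_(w : B | P w && ((a <= w)%O && (w <= b)%O))
      sign (rk w) * sign c)%R; last first.
    apply: eq_bigl => w; rewrite andb_idl // => /andP[aw wb].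
    exact: convex (valP z) (valP z') aw wb.
  rewrite -(big_sub_poset P (fun w => (a <= w) && (w <= b))
    (fun w => sign (rk w) * sign c)%R).
  by apply: eq_bigr => w _; rewrite rE signD.
by rewrite eulB ?mul0r.
Qed.

(** * Strong formal subdivisions *)

Lemma sfs_fibre_sum (X Y : rposet) (s : X -> Y) (x : X) (y : Y) :
  strong_formal_subdivision s -> s x <= y ->
  (\sum_(x' : X | (x <= x')%O && (s x' == y)) sign (rk x') = sign (rk y))%R.
Proof. by move=> [_ _ _ sE] /sE /sum_sign_fibre. Qed.

(** When [f x <= y], the fibre of [y] above [x] is the single element [g y], of
    rank [rk y]. *)
Lemma sfs_iso (X Y : rposet) (f : X -> Y) (g : Y -> X) :
  cancel f g -> cancel g f -> {mono f : x x' / x <= x'} ->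
  (forall x, rk (f x) = rk x) -> strong_formal_subdivision f.
Proof.
move=> fK gK fm fr; have gm y y' : (g y <= g y') = (y <= y') by rewrite -fm !gK.
split=> [x x'|x||x y fxy]; [by rewrite fm|by rewrite fr| |].
  split=> [y|x y fxy]; first by exists (g y); rewrite gK.
  by exists (g y); rewrite gK -fr gK -fm gK.
rewrite (big_pred1 (g y)) => [|x' /=]; first by rewrite -fr gK subrr expr0z.
apply/andP/eqP => [[_ /eqP <-]|->]; first by rewrite fK.
by rewrite gK -fm gK.
Qed.

Lemma sfs_zero (X Y : eulpos) (s : X -> Y) :
  strong_formal_subdivision s -> s (zero X) = zero Y.
Proof.
move=> [sO _ [sS _] _]; apply/esym/zeroE => y.
by have [x <-] := sS y; exact/sO/zero_le.
Qed.

Lemma lower_eulerian_least (B : rposet) (m : B) :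
  locally_eulerian B -> (forall z, m <= z) -> lower_eulerian B.
Proof.
by move=> eulB m0; split=> //; exists m; apply/unique_minimalP; rewrite inE.
Qed.

(** * The mapping cylinder *)

Section CylinderObject.
Variable s : Subdiv.
Local Notation X := (sdom s).
Local Notation Y := (scod s).
Implicit Types (x : X) (y : Y).

Lemma cyl_le_ll x x' : (cyl_inl x <= cyl_inl x') = (x <= x').
Proof. by []. Qed.

Lemma cyl_le_lr x y : (cyl_inl x <= cyl_inr y) = (sfun x <= y).
Proof. by []. Qed.

Lemma cyl_le_rl x y : (cyl_inr y <= cyl_inl x) = false.
Proof. by []. Qed.

Lemma cyl_le_rr y y' : (cyl_inr y <= cyl_inr y') = (y <= y').
Proof. by []. Qed.

Definition cyl_leE := (cyl_le_ll, cyl_le_lr, cyl_le_rl, cyl_le_rr).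

Lemma cyl_lt_ll x x' : (cyl_inl x < cyl_inl x') = (x < x').
Proof. by rewrite !lt_leAnge !cyl_leE. Qed.

Lemma cyl_lt_lr x y : (cyl_inl x < cyl_inr y) = (sfun x <= y).
Proof. by rewrite lt_leAnge !cyl_leE andbT. Qed.

Lemma cyl_lt_rl x y : (cyl_inr y < cyl_inl x) = false.
Proof. by rewrite lt_leAnge !cyl_leE. Qed.

Lemma cyl_lt_rr y y' : (cyl_inr y < cyl_inr y') = (y < y').
Proof. by rewrite !lt_leAnge !cyl_leE. Qed.

Definition cyl_ltE := (cyl_lt_ll, cyl_lt_lr, cyl_lt_rl, cyl_lt_rr).

Lemma big_cyl (P : pred (Cyl s)) (F : Cyl s -> int) :
  (\sum_(z | P z) F z = \sum_(x | P (cyl_inl x)) F (cyl_inl x)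
                        + \sum_(y | P (cyl_inr y)) F (cyl_inr y))%R.
Proof. exact: big_sumType. Qed.

Lemma sfunP : strong_formal_subdivision (@sfun s).
Proof. exact: sfsP (arr s). Qed.

(** The mixed case is where strong surjectivity enters: if [y] covers [x], then
    [sfun x <= y] lifts to some [x' >= x] with [sfun x' = y] and the rank of
    [y], and [x < x'] would put [x'] strictly between [x] and [y]. *)
Lemma cyl_rank : is_rank_function (@rk (Cyl s)).
Proof.
have [[[rkX _] _] [[rkY _] _]] := (eulP X, eulP Y).
case=> [x|y] [x'|y'] /andP[]; rewrite -!/(cyl_inl _) -!/(cyl_inr _) ?cyl_ltE //.
- move=> xx' /forallP no; apply: rkX; apply/andP; split=> //.
  by apply/forallP => w; move: (no (cyl_inl w)); rewrite !cyl_ltE.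
- move=> sxy /forallP no; have [_ _ [_ sL] _] := sfunP.
  have [x' [xx' rx' sx']] := sL _ _ sxy.
  move: (no (cyl_inl x')); rewrite !cyl_ltE sx' lexx andbT lt_neqAle xx' andbT.
  by rewrite negbK => /eqP ->; rewrite /= rx'.
- move=> yy' /forallP no; congr (_ + 1)%R; apply: rkY; apply/andP; split=> //.
  by apply/forallP => w; move: (no (cyl_inr w)); rewrite !cyl_ltE.
Qed.

(** Group the [x'] by their image [y']: by the sign condition each fibre
    contributes what [y'] itself does. *)
Lemma cyl_mixed_sum x y : sfun x <= y ->
  (\sum_(x' : X | (x <= x')%O && (sfun x' <= y)%O) sign (rk x') =
   \sum_(y' : Y | (sfun x <= y')%O && (y' <= y)%O) sign (rk y'))%R.
Proof.
move=> sxy; rewrite (partition_big (@sfun s)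
    (fun y' => (sfun x <= y') && (y' <= y))) /=; last first.
  by move=> x' /andP[xx' ->]; rewrite (sfun_homo xx').
apply: eq_bigr => y' /andP[sxy' y'y]; rewrite -(sfs_fibre_sum sfunP sxy').
by apply: eq_bigl => x'; case: (sfun x' =P y') => [->|]; rewrite ?y'y ?andbT ?andbF.
Qed.

Lemma cyl_locally_eulerian : locally_eulerian (Cyl s).
Proof.
split; first exact: cyl_rank.
have [[[_ eulX] _] [[_ eulY] _]] := (eulP X, eulP Y).
case=> [x|y] [x'|y']; rewrite -!/(cyl_inl _) -!/(cyl_inr _) ?cyl_ltE // => lt_zz';
  rewrite big_cyl.
- rewrite [X in (_ + X)%R]big1 ?addr0; first exact: eulX.
  by move=> y; rewrite !cyl_leE andbF.
- rewrite [X in (X + _)%R](cyl_mixed_sum lt_zz') -big_split big1 //= => y _.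
  by rewrite signD mulrN1 subrr.
rewrite [X in (X + _)%R]big1 ?add0r => [|x]; last by rewrite !cyl_leE.
transitivity ((\sum_(w : Y | (y <= w)%O && (w <= y')%O) sign (rk w)) * -1)%R.
  by rewrite mulr_suml; apply: eq_bigr => w _; rewrite signD.
by rewrite eulY ?mul0r.
Qed.

Lemma cyl_inl_zero_le z : cyl_inl (zero X) <= z.
Proof.
case: z => [x|y]; rewrite -!/(cyl_inl _) -!/(cyl_inr _) cyl_leE ?zero_le //.
by rewrite (sfs_zero sfunP) zero_le.
Qed.

(** Formulated for an arbitrary [w], this gives both the existence of the join
    of [x] with the distinguished point and the value of [joinq] at [x]. *)
Lemma cyl_join_lub x (w : Cyl s) :
  (cyl_inr (sfun x) <= w) = (cyl_inl x <= w) && (cyl_inr (zero Y) <= w).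
Proof.
by case: w => w; rewrite -!/(cyl_inl _) -!/(cyl_inr _) !cyl_leE ?andbF ?zero_le ?andbT.
Qed.

Lemma cyl_wd : CYL_object_wd s.
Proof.
split; first exact: lower_eulerian_least cyl_locally_eulerian cyl_inl_zero_le.
split.
  apply/unique_minimalP => -[_ /(_ (cyl_inl (zero X)))].
  by rewrite inE cyl_leE => /(_ isT).
case=> [x|y].
  exists (cyl_inr (sfun x)); apply/unique_minimalP; rewrite !inE.
  split=> [|w]; rewrite -!/(cyl_inl _) -?cyl_join_lub //.
  by rewrite !inE -cyl_join_lub.
exists (cyl_inr y); apply/unique_minimalP; rewrite !inE -!/(cyl_inr _) !cyl_leE.
by rewrite zero_le lexx; split=> // w; rewrite !inE => /andP[].
Qed.

End CylinderObject.

(** * Splitting a poset at a join-admissible element *)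

Section JoinAdmissibleObject.
Variable G : join_adm.
Local Notation q := (ja_pt G).
Implicit Types x y z w : G.

Lemma ja_pt_not_le_zero : ~~ (q <= zero G).
Proof.
apply: contra (proj1 (ja_ptP G)) => q0; apply/unique_minimalP; rewrite inE.
by split=> // z _; exact: le_trans q0 (zero_le z).
Qed.

(** The interval [[x, y]] consists of the interval [[joinq x, y]] and, for each
    [w] in it, of the fibre of [joinq] over [w] above [x].  Its signed sum is
    zero, and by induction the fibres over the [w < y] cancel against these
    [w]; hence so do the fibre over [y] and [y]. *)
Lemma joinq_fibre_sum x y : ~~ (q <= x) -> joinq x <= y ->
  (\sum_(w : G | [&& ~~ (q <= w)%O, (x <= w)%O & joinq w == y]) sign (rk w)
   = - sign (rk y))%R.
Proof.
move=> qx; have [[_ eulG] _] := eulP G.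
elim/(@lt_fin_ind _ G): y => y IH jxy.
have := eulG _ _ (lt_le_trans (lt_joinq qx) jxy).
rewrite (bigID (fun w => q <= w)) /= addrC.
rewrite [X in (X + _)%R](partition_big (@joinq G)
  (fun w => (joinq x <= w) && (w <= y))) /=; last first.
  move=> w /andP[/andP[xw wy] _].
  rewrite !joinq_le (le_trans xw (le_joinq w)) joinq_upper wy /=.
  by move: jxy; rewrite joinq_le => /andP[].
rewrite [X in (_ + X)%R](eq_bigl (fun w => (joinq x <= w) && (w <= y))); last first.
  by move=> w; rewrite /= joinq_le andbAC.
rewrite -big_split /= (bigD1 y) /=; last by rewrite jxy lexx.
rewrite [X in (_ + X)%R]big1 => [|w /andP[/andP[jxw wy] ney]].
  rewrite addr0 => /addr0_eq <-; rewrite opprK.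
  apply: eq_bigl => w; case: (joinq w =P y) => [<-|]; rewrite ?andbF //.
  by rewrite le_joinq !andbT andbC.
rewrite (eq_bigl (fun w' => [&& ~~ (q <= w'), x <= w' & joinq w' == w])).
  by rewrite IH ?addNr // lt_neqAle ney.
move=> w'; case: (joinq w' =P w) => [jw|]; rewrite ?andbF //.
by rewrite -jw in wy; rewrite (le_trans (le_joinq w') wy) !andbT andbC.
Qed.

(** The fibre over [y] is nonempty because its signed sum is nonzero.  Take a
    maximal element [w] of it.  Nothing lies strictly between [w] and [y]: such
    a [u] is not above [q], since otherwise [y = joinq w <= u], and then it
    belongs to the fibre as well. *)
Lemma joinq_strongly_surjective x y : ~~ (q <= x) -> joinq x <= y ->
  exists w, [/\ ~~ (q <= w), x <= w, rk y = (rk w + 1)%R & joinq w = y].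
Proof.
move=> qx jxy; have [[rkG _] _] := eulP G.
pose A w := [&& ~~ (q <= w), x <= w & joinq w == y].
have [w0 Aw0] : exists w, A w.
  apply/existsP; apply: contraT => /existsPn none.
  have := joinq_fibre_sum qx jxy; rewrite big1 => [/eqP|w Aw].
    by rewrite eq_sym oppr_eq0 expfz_eq0 oppr_eq0 oner_eq0 andbF.
  by move: (none w); rewrite /A Aw.
have [w [/and3P[qw xw /eqP jw] _ max_w]] := exists_maximal Aw0.
exists w; split=> //; apply: rkG; apply/andP; split.
  by rewrite -jw lt_joinq.
apply/forallP => u; apply/negP => /andP[wu uy].
have wu' := ltW wu; have qu : ~~ (q <= u).
  by apply/negP => qu; move: (lt_geF uy); rewrite -jw joinq_le wu' qu.
move/negP: (max_w u wu); apply; rewrite /A qu (le_trans xw wu') /=.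
by rewrite eq_le joinq_le (ltW uy) -jw joinq_le !joinq_upper (le_trans wu' (le_joinq u)).
Qed.

End JoinAdmissibleObject.

Section JoinMap.
Variable G : JoinAdm.
Local Notation q := (ja_pt (G : join_adm)).

Definition lower_zero : lower_part G :=
  exist (fun z : (G : join_adm) => ~~ (q <= z)) _ (ja_pt_not_le_zero G).

Definition upper_zero : upper_part G :=
  exist (fun z : (G : join_adm) => q <= z) q (lexx q).

Lemma join_map_le (x : lower_part G) (y : upper_part G) :
  (join_map x <= y) = (val x <= val y).
Proof. by rewrite leEsub /= joinq_le (valP y) andbT. Qed.

Lemma join_map_sfs : strong_formal_subdivision (@join_map G).
Proof.
have [[rkG _] _] := eulP (G : join_adm).
have strong (x : lower_part G) (y : upper_part G) : join_map x <= y ->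
    exists x' : lower_part G, [/\ x <= x', rk x' = rk y & join_map x' = y].
  move=> jxy; have [w [qw xw rw jw]] :=
    joinq_strongly_surjective (valP x) (jxy : joinq (val x) <= val y).
  exists (Sub w qw); split=> //; first by rewrite /= rw addrK.
  exact: val_inj.
split=> [x x' xx'|x||x y jxy].
- by rewrite join_map_le; apply: le_trans (le_joinq _); exact: xx'.
- by rewrite /= lerBrDr -ltzD1 ltrD2r; exact: (rank_lt rkG (lt_joinq (valP x))).
- split=> // y.
  have [|x [_ _ <-]] := strong lower_zero y; last by exists x.
  by rewrite join_map_le zero_le.
apply/sum_sign_fibre; rewrite /= signD mulrN1.
rewrite -(joinq_fibre_sum (valP x) (jxy : joinq (val x) <= val y)).
rewrite -(big_sub_poset (fun w : (G : join_adm) => ~~ (q <= w))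
  (fun w => ((val x : (G : join_adm)) <= w) && (joinq w == val y))
  (fun w => sign (rk w))).
by apply: eq_bigl => w; rewrite -val_eqE.
Qed.

(** The two parts are a down-set and an up-set, hence convex; their least
    elements are that of [G] and [q]. *)
Lemma map_wd : MAP_object_wd G.
Proof.
have eulG := eulP (G : join_adm).
split; last split; last exact: join_map_sfs.
  apply: (@lower_eulerian_least _ lower_zero); last first.
    by move=> z; exact: zero_le.
  apply: (@locally_eulerian_convex _ _ _ 0); last exact: proj1 eulG.
    by move=> z w z' qz qz' zw wz'; apply: contra qz' => /le_trans; apply.
  by move=> z; rewrite addr0.
apply: (@lower_eulerian_least _ upper_zero); last by move=> z; exact: valP z.
apply: (@locally_eulerian_convex _ _ _ (-1)) => //; last exact: proj1 eulG.
by move=> z w z' qz qz' zw wz'; exact: le_trans zw.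
Qed.

End JoinMap.

(** * The functor CYL *)

Section CylinderMorphism.
Variables (s s' : Subdiv) (f : Mor s s').

Lemma sq_commE (x : sdom s) : sq_cod f (sfun x) = sfun (sq_dom f x).
Proof. by have /(congr1 (fun h => sfs_fun h x)) := sq_comm f. Qed.

Definition cyl_map (z : Cyl s) : Cyl s' :=
  match z with
  | inl x => cyl_inl (sq_dom f x)
  | inr y => cyl_inr (sq_cod f y)
  end.

Lemma cyl_map_sfs : strong_formal_subdivision cyl_map.
Proof.
have [fO fR [fS fL] fE] := sfsP (sq_dom f : sfs_map _ _).
have [gO gR [gS gL] gE] := sfsP (sq_cod f : sfs_map _ _).
split.
- case=> [x|y] [x'|y']; rewrite /cyl_map -!/(cyl_inl _) -!/(cyl_inr _) !cyl_leE //.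
  + exact: fO.
  + by rewrite -sq_commE; exact: gO.
  + exact: gO.
- by case=> [x|y] /=; [exact: fR|rewrite lerD2r; exact: gR].
- split=> [[x'|y']|].
  + by have [x <-] := fS x'; exists (cyl_inl x).
  + by have [y <-] := gS y'; exists (cyl_inr y).
  case=> [x|y] [x'|y']; rewrite /cyl_map -!/(cyl_inl _) -!/(cyl_inr _) !cyl_leE //
    => le_zz'.
  + have [w [xw rw fw]] := fL _ _ le_zz'.
    by exists (cyl_inl w); split; rewrite //= -fw.
  + rewrite -sq_commE in le_zz'; have [w [xw rw gw]] := gL _ _ le_zz'.
    by exists (cyl_inr w); split; rewrite //= ?rw -?gw.
  + have [w [xw rw gw]] := gL _ _ le_zz'.
    by exists (cyl_inr w); split; rewrite //= ?rw -?gw.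
have shift (k l : int) : (k + 1 - (l + 1) = k - l)%R by rewrite opprD addrACA subrr addr0.
case=> [x|y] [x'|y']; rewrite /= -!/(cyl_inl _) -!/(cyl_inr _) !cyl_leE // => le_zz';
  rewrite big_cyl /=.
- rewrite [X in (_ + X)%R]big1 ?addr0; first exact: fE.
  by move=> y /andP[_ /eqP].
- rewrite -sq_commE in le_zz'; rewrite [X in (X + _)%R]big1 ?add0r.
    rewrite -[RHS](gE _ _ le_zz'); apply: eq_bigr => w _.
    by rewrite shift.
  by move=> w /andP[_ /eqP].
- rewrite [X in (X + _)%R]big1 ?add0r.
    rewrite -[RHS](gE _ _ le_zz'); apply: eq_bigr => w _.
    by rewrite shift.
  by [].
Qed.

End CylinderMorphism.

Local Notation CYL_obj := (CYL_object cyl_wd).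

Lemma cyl_joinq (s : Subdiv) (x : sdom s) :
  joinq (cyl_inl x : CYL_obj s) = cyl_inr (sfun x).
Proof. by apply: joinqE => w; exact: cyl_join_lub. Qed.

Lemma cyl_map_ja (s s' : Subdiv) (f : Mor s s') :
  @join_adm_morphism (CYL_obj s) (CYL_obj s') (cyl_map f).
Proof.
split; first exact: cyl_map_sfs.
  by congr inr; exact: sfs_zero (sfsP (sq_cod f)).
case=> [x _|y]; last by rewrite -/(cyl_inr _) cyl_le_rr zero_le.
by rewrite -/(cyl_inl _) cyl_joinq /= sq_commE; exact/esym/cyl_joinq.
Qed.

Definition CYL_map (s s' : Subdiv) (f : Mor s s') :
    @Mor JoinAdm (CYL_obj s) (CYL_obj s') :=
  JaMap (cyl_map_ja f).

Lemma CYL_map1 (s : Subdiv) : CYL_map (idmor s) = idmor (CYL_obj s).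
Proof. by apply: ja_map_eq => -[]. Qed.

Lemma CYL_mapM (s t u : Subdiv) (g : Mor t u) (f : Mor s t) :
  CYL_map (compm g f) = compm (CYL_map g) (CYL_map f).
Proof. by apply: ja_map_eq => -[]. Qed.

Definition CYL : functor_on CYL_obj := Functor CYL_map1 CYL_mapM.

(** * The functor MAP *)

Section Restriction.
Variables (X Y : rposet) (s : X -> Y) (P : pred X) (P' : pred Y).
Variables (rX : sub_poset P -> int) (rY : sub_poset P' -> int) (c : int).
Hypothesis sP : forall x, P' (s x) = P x.
Hypothesis rXE : forall x, rX x = (rk (val x) + c)%R.
Hypothesis rYE : forall y, rY y = (rk (val y) + c)%R.

Lemma restrict_subproof (x : sub_poset P) : P' (s (val x)).
Proof. by rewrite sP; exact: valP x. Qed.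

Definition restrict (x : sub_poset P) : sub_poset P' :=
  exist P' (s (val x)) (restrict_subproof x).

(** Since [P] is the full preimage of [P'], it contains the whole fibre of each
    element of [P'] and every lifting of such an element; and shifting both
    ranks by [c] leaves their differences unchanged. *)
Lemma restrict_sfs : strong_formal_subdivision s ->
  @strong_formal_subdivision (@RPoset _ (sub_poset P) rX)
    (@RPoset _ (sub_poset P') rY) restrict.
Proof.
move=> [sO sR [sS sL] sE]; split.
- by move=> x x'; exact: sO.
- by move=> x; rewrite /= rXE rYE lerD2r; exact: sR.
- split=> [y|x y sxy].
    have [x sx] := sS (val y).
    have Px : P x by rewrite -sP sx; exact: valP y.
    by exists (exist P x Px); exact: val_inj.
  have [x' [xx' rx' sx']] := sL (val x) (val y) sxy.
  have Px' : P x' by rewrite -sP sx'; exact: valP y.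
  exists (exist P x' Px'); split=> //; last exact: val_inj.
  by rewrite /= rXE rYE /= rx'.
move=> x y sxy; apply/sum_sign_fibre => /=; rewrite rYE signD.
have [_ _ _ /(_ (val x) (val y) sxy)/sum_sign_fibre <-] :
  strong_formal_subdivision s by split.
rewrite mulr_suml; transitivity (\sum_(w : X | P w &&
    (((val x : X) <= w)%O && (s w == val y))) sign (rk w) * sign c)%R;
  last first.
  apply: eq_bigl => w; rewrite andb_idl // => /andP[_ /eqP sw].
  by rewrite -sP sw; exact: valP y.
rewrite -(big_sub_poset P (fun w => ((val x : X) <= w) && (s w == val y))
  (fun w => sign (rk w) * sign c)%R).
by apply: eq_big => [w|w _]; [rewrite -val_eqE | rewrite rXE signD].
Qed.

End Restriction.

Section MapMorphism.
Variables (G G' : JoinAdm) (phi : Mor G G').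
Local Notation q := (ja_pt (G : join_adm)).
Local Notation q' := (ja_pt (G' : join_adm)).

(** Suppose [q' <= phi z] but not [q <= z]; take [m >= z] maximal with
    [phi m = phi z] and not above [q].  As [joinq m] has the same image, the
    fibre sums above [m] and above [joinq m] are equal.  But by maximality the
    former is the latter plus the single term of [m], which is not zero. *)
Lemma ja_map_pt_le (z : (G : join_adm)) : (q' <= phi z) = (q <= z).
Proof.
have [phiS phiq phij] := ja_mapP phi; have [phiO _ _ _] := phiS.
apply/idP/idP => [qz|]; last by rewrite -phiq; exact: phiO.
apply: contraT => nqz; pose y := phi z.
have [m [/andP[nqm /eqP my] _ max_m]] :=
  @exists_maximal _ _ [pred w | ~~ (q <= w) && (phi w == y)] z
    (introT andP (conj nqz (eqxx _))).
have eqle (u : G : join_adm) : phi u = y -> phi u <= y by move=> ->.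
have jmy : phi (joinq m) = y by rewrite phij // joinq_ge my.
have := sfs_fibre_sum phiS (eqle _ my).
rewrite (bigD1 m) ?lexx ?my ?eqxx //=.
rewrite (eq_bigl (fun w => (joinq m <= w) && (phi w == y))) => [|w].
  rewrite (sfs_fibre_sum phiS (eqle _ jmy)) => /(canRL (addrK _)) /eqP.
  by rewrite subrr expfz_eq0 oppr_eq0 oner_eq0 andbF.
rewrite joinq_le; case: (phi w =P y) => [wy|]; rewrite ?andbF // !andbT.
have [->|nwm] := eqVneq w m; first by rewrite (negPf nqm) !andbF.
rewrite andbT; have [mw|//] := boolP (m <= w).
have lt_mw : m < w by rewrite lt_neqAle eq_sym nwm.
by move: (max_m _ lt_mw); rewrite /= wy eqxx andbT negbK.
Qed.

Lemma map_lower_sfs :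
  @strong_formal_subdivision (lower_part G) (lower_part G')
    (restrict (fun z => congr1 negb (ja_map_pt_le z))).
Proof.
have [phiS _ _] := ja_mapP phi.
by apply: (restrict_sfs (c := 0)) => // z; rewrite addr0.
Qed.

Lemma map_upper_sfs :
  @strong_formal_subdivision (upper_part G) (upper_part G') (restrict ja_map_pt_le).
Proof. by have [phiS _ _] := ja_mapP phi; exact: (restrict_sfs (c := -1)). Qed.

Lemma MAP_square :
  let S := MAP_object map_wd G in let S' := MAP_object map_wd G' in
  @compm EulPos (dom S) (cod S) (cod S') (SfsMap map_upper_sfs) (arr S) =
  @compm EulPos (dom S) (dom S') (cod S') (arr S') (SfsMap map_lower_sfs).
Proof.
apply: sfs_map_eq => x; apply: val_inj => /=.
by have [_ _ ->] := ja_mapP phi; last exact: valP x.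
Qed.

Definition MAP_map : @Mor Subdiv (MAP_object map_wd G) (MAP_object map_wd G') :=
  Square MAP_square.

End MapMorphism.

Lemma MAP_map1 (G : JoinAdm) : MAP_map (idmor G) = idmor (MAP_object map_wd G).
Proof. by apply: square_eq; apply: sfs_map_eq => z; exact: val_inj. Qed.

Lemma MAP_mapM (G1 G2 G3 : JoinAdm) (g : Mor G2 G3) (f : Mor G1 G2) :
  MAP_map (compm g f) = compm (MAP_map g) (MAP_map f).
Proof. by apply: square_eq; apply: sfs_map_eq => z; exact: val_inj. Qed.

Definition MAP : functor_on (MAP_object map_wd) := Functor MAP_map1 MAP_mapM.

(** * The two composites *)

(** The inverse square commutes because the given one does. *)
Lemma square_isomorphism (C : category) (s t : arrow C) (f : square s t) :
  isomorphism (sq_dom f) -> isomorphism (sq_cod f) ->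
  @isomorphism (arrow_category C) s t f.
Proof.
move=> [g1 [g1f fg1]] [g2 [g2f fg2]].
have comm : compm g2 (arr t) = compm (arr s) g1.
  rewrite -[arr t]compm1 -fg1 (Defs.compA (arr t)) -sq_comm -Defs.compA.
  by rewrite (Defs.compA g2) g2f comp1m.
by exists (Square comm); split; apply: square_eq.
Qed.

(** The inverse respects joins with the distinguished point because [phi]
    reflects the relation of being above it. *)
Lemma ja_isomorphism (G G' : JoinAdm) (phi : Mor G G') (g : G' -> G) :
  strong_formal_subdivision g -> cancel phi g -> cancel g phi -> isomorphism phi.
Proof.
move=> gS phiK gK; have [_ phiq phij] := ja_mapP phi.
have gP : @join_adm_morphism G' G g.
  split=> [//||z qz]; first by rewrite -phiq phiK.
  by rewrite -{1}(gK z) -phij ?phiK // -(ja_map_pt_le phi) gK.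
by exists (JaMap gP); split; apply: ja_map_eq.
Qed.

Section Unit.
Variable s : Subdiv.
Local Notation T := (MAP_object map_wd (CYL_obj s)).

Definition unit_dom (x : sdom s) : sdom T :=
  exist (fun z : Cyl s => ~~ (cyl_inr (zero (scod s)) <= z)) (cyl_inl x) isT.

Definition unit_cod (y : scod s) : scod T :=
  exist (fun z : Cyl s => cyl_inr (zero (scod s)) <= z) (cyl_inr y) (zero_le y).

(** No element of the lower part of a cylinder comes from the target, so the
    default value is never taken; likewise for the upper part below. *)
Definition unit_dom_inv (z : sdom T) : sdom s :=
  if val z is inl x then x else zero (sdom s).

Definition unit_cod_inv (z : scod T) : scod s :=
  if val z is inr y then y else zero (scod s).

Lemma unit_domK : cancel unit_dom unit_dom_inv.
Proof. by []. Qed.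

Lemma unit_codK : cancel unit_cod unit_cod_inv.
Proof. by []. Qed.

Lemma unit_dom_invK : cancel unit_dom_inv unit_dom.
Proof.
case=> -[x|y] qz; apply: val_inj => //.
by have := qz; rewrite -/(cyl_inr y) cyl_le_rr zero_le.
Qed.

Lemma unit_cod_invK : cancel unit_cod_inv unit_cod.
Proof. by case=> -[x|y] qz; apply: val_inj. Qed.

Lemma unit_dom_sfs : strong_formal_subdivision unit_dom.
Proof. exact: (sfs_iso unit_domK unit_dom_invK). Qed.

Lemma unit_cod_sfs : strong_formal_subdivision unit_cod.
Proof. by apply: (sfs_iso unit_codK unit_cod_invK) => // y; rewrite /= addrK. Qed.

Lemma unit_comm :
  @compm EulPos (dom s) (cod s) (cod T) (SfsMap unit_cod_sfs) (arr s) =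
  @compm EulPos (dom s) (dom T) (cod T) (arr T) (SfsMap unit_dom_sfs).
Proof. by apply: sfs_map_eq => x; apply: val_inj; exact/esym/cyl_joinq. Qed.

Definition unit_map : Mor s T := Square unit_comm.

Lemma unit_iso : isomorphism unit_map.
Proof.
apply: square_isomorphism; apply/EulPos_isoP; split=> //=.
- exact: Bijective unit_domK unit_dom_invK.
- exact: Bijective unit_codK unit_cod_invK.
- by move=> y; rewrite addrK.
Qed.

End Unit.

Section Counit.
Variable G : JoinAdm.
Local Notation q := (ja_pt (G : join_adm)).
Local Notation T := (CYL_obj (MAP_object map_wd G)).

Definition counit_fun (z : T) : (G : join_adm) :=
  match z with inl x => val x | inr y => val y end.

(** The default value of [insubd] is reached for no [z]: when the first test
    fails, [z] lies above [q]. *)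
Definition counit_inv (z : (G : join_adm)) : T :=
  if insub z is Some x then @cyl_inl (MAP_object map_wd G) x
  else @cyl_inr (MAP_object map_wd G) (insubd (upper_zero G) z).

Lemma counit_funK : cancel counit_fun counit_inv.
Proof.
case=> z; rewrite /counit_inv /=; first by rewrite valK.
by rewrite insubN ?valKd // negbK; exact: valP z.
Qed.

Lemma counit_invK : cancel counit_inv counit_fun.
Proof.
move=> z; rewrite /counit_inv; case: insubP => [x _ //|/=].
by rewrite negbK => qz; rewrite insubdK.
Qed.

(** For [x] in the lower and [y] in the upper part, [x <= y] is decided by
    [join_map_le], and [y <= x] is impossible since it would put [x] above [q]. *)
Lemma counit_mono : {mono counit_fun : z z' / z <= z'}.
Proof.
case=> [x|y] [x'|y'] //=.
  exact/esym/join_map_le.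
apply/negbTE; apply: contra (valP x'); exact: le_trans (valP y).
Qed.

Lemma counit_rank z : rk (counit_fun z) = rk z.
Proof. by case: z => z //=; rewrite subrK. Qed.

Lemma counit_ja : @join_adm_morphism T G counit_fun.
Proof.
split; first exact: sfs_iso counit_funK counit_invK counit_mono counit_rank.
  rewrite /= (@zeroE (scod (MAP_object map_wd G)) (upper_zero G)) // => y.
  exact: valP y.
case=> [x _|y]; last by rewrite -/(cyl_inr _) cyl_le_rr zero_le.
by rewrite -/(@cyl_inl (MAP_object map_wd G) x) cyl_joinq.
Qed.

Definition counit_map : Mor T G := JaMap counit_ja.

Lemma counit_iso : isomorphism counit_map.
Proof.
apply: (ja_isomorphism (g := counit_inv)); last exact: counit_invK.
  apply: sfs_iso counit_invK counit_funK _ _ => [z z'|z].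
    by rewrite -counit_mono !counit_invK.
  by rewrite -counit_rank counit_invK.
exact: counit_funK.
Qed.

End Counit.

Theorem theorem1p2 :
  exists (cyl_wd : forall s : Subdiv, CYL_object_wd s)
         (map_wd : forall G : JoinAdm, MAP_object_wd G)
         (CYL : functor_on (CYL_object cyl_wd))
         (MAP : functor_on (MAP_object map_wd)),
    (forall (s s' : Subdiv) (f : Mor s s'),
       (forall x : sdom s, fmap CYL f (cyl_inl x) = cyl_inl (sq_dom f x)) /\
       (forall y : scod s, fmap CYL f (cyl_inr y) = cyl_inr (sq_cod f y))) /\
    (forall (G G' : JoinAdm) (phi : Mor G G'),
       (forall x : lower_part G,
          val (sq_dom (fmap MAP phi) x) = phi (val x)) /\
       (forall y : upper_part G,
          val (sq_cod (fmap MAP phi) y) = phi (val y))) /\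
    (exists eta : forall s : Subdiv,
         Mor s (MAP_object map_wd (CYL_object cyl_wd s)),
       (forall (s : Subdiv),
         (forall x : sdom s, val (sq_dom (eta s) x) = cyl_inl x) /\
         (forall y : scod s, val (sq_cod (eta s) y) = cyl_inr y)) /\
       natural_isomorphism (functor_id Subdiv) (functor_comp MAP CYL) eta) /\
    (exists eps : forall G : JoinAdm,
         Mor (CYL_object cyl_wd (MAP_object map_wd G)) G,
       (forall G : JoinAdm,
         (forall x : lower_part G, eps G (@cyl_inl (MAP_object map_wd G) x) = val x) /\
         (forall y : upper_part G, eps G (@cyl_inr (MAP_object map_wd G) y) = val y)) /\
       natural_isomorphism (functor_comp CYL MAP) (functor_id JoinAdm) eps).
Proof.
exists cyl_wd, map_wd, CYL, MAP; split; first by [].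
split; first by [].
split.
  exists unit_map; split; first by [].
  split; first exact: unit_iso.
  by move=> s t f; apply: square_eq; apply: sfs_map_eq => z; exact: val_inj.
exists counit_map; split; first by [].
split; first exact: counit_iso.
by move=> G G' f; apply: ja_map_eq => -[].
Qed.
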